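(* Let $p$ be an odd prime, let $q\in\mathbb{C}_p$ with $|q-1|_p<1$ and $q$ not a root of unity, let $\alpha,\beta,k$ be positive integers, and let $\chi$ be a Dirichlet character with odd conductor $d$, $(d,p)=1$. Then $$\int_{X}d\mu_{k,q}^{(\alpha,\beta)}(x\mid\chi)=\widetilde{\mathcal{E}}_{k,q}^{\chi}(\alpha:\beta).$$
   Context: $X=\varprojlim_N\mathbb{Z}/dp^{N}\mathbb{Z}$, and $a+dp^N\mathbb{Z}_p$ ($0\le a<dp^N$) denotes $\{x\in X: x\equiv a \bmod dp^N\}$. $\mathbb{C}_p$ is the completion of an algebraic closure of $\mathbb{Q}_p$; values of $\chi$ are viewed in $\mathbb{C}_p$ via a fixed embedding. For $Q\ne1$, $[y:Q]=\frac{Q^{y}-1}{Q-1}$, so $[N:-Q]=\frac{1-(-Q)^N}{1+Q}$. For integers $n\ge 0$, $$\widetilde{\mathcal{E}}_{n,q}^{\chi}(\alpha:\beta)=\lim_{N\to\infty}\frac{1}{[dp^{N}:-q^{\beta}]}\sum_{y=0}^{dp^{N}-1}(-q^{\beta})^{y}\chi(y)[y:q^{\alpha}]^{n}.$$ For integers $M\ge1$ and $a\ge 0$, the weighted $(\alpha,\beta)$ $q$-Euler polynomial in base $q^{M}$ at $a/M$ is $$\widetilde{E}_{n,q^{M}}\!\left(\tfrac{a}{M}\,\Big|\,\alpha:\beta\right)=\lim_{N\to\infty}\frac{1}{[p^{N}:-q^{M\beta}]}\sum_{y=0}^{p^{N}-1}(-q^{M\beta})^{y}\left(\frac{1-q^{\alpha(a+My)}}{1-q^{\alpha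 M}}\right)^{n},$$ where the quantity in parentheses is $[\frac{a}{M}+y:q^{M\alpha}]$. The $p$-adic Dirichlet type $q$-Euler measure is given by $$\mu_{k,q}^{(\alpha,\beta)}(a+dp^{N}\mathbb{Z}_p\mid\chi)=\frac{[dp^{N}:q^{\alpha}]^{k}}{[dp^{N}:-q^{\beta}]}\,\chi(a)(-1)^{a}q^{\beta a}\,\widetilde{E}_{k,q^{dp^{N}}}\!\left(\tfrac{a}{dp^{N}}\,\Big|\,\alpha:\beta\right),\quad 0\le a<dp^N,$$ and $\int_X d\mu_{k,q}^{(\alpha,\beta)}(x\mid\chi):=\lim_{N\to\infty}\sum_{a=0}^{dp^{N}-1}\mu_{k,q}^{(\alpha,\beta)}(a+dp^{N}\mathbb{Z}_p\mid\chi)$. *)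

(* Defs.v *)
From HB Require Import structures.
From mathcomp Require Import all_boot all_order all_algebra all_field.
From mathcomp Require Import boolp classical_sets reals topology normedtype.
From mathcomp Require Import sequences.

Set Implicit Arguments.
Unset Strict Implicit.
Unset Printing Implicit Defensive.

Import Order.TTheory GRing.Theory Num.Theory.
Import numFieldNormedType.Exports.

Local Open Scope classical_set_scope.
Local Open Scope ring_scope.

Section ValuedFields.
Variable R : realType.

Record ultrametric_abs (K : fieldType) (v : K -> R) : Prop := UltrametricAbs {
  uabs_ge0 : forall x, 0 <= v x;
  uabs_eq0 : forall x, v x = 0 <-> x = 0;
  uabsM : forall x y, v (x * y) = v x * v y;
  uabsD : forall x y, v (x + y) <= Num.max (v x) (v y) }.

Definition vcvg (K : fieldType) (v : K -> R) (u : nat -> K) (l : K) : Prop :=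
  (fun n => v (u n - l)) @ \oo --> (0 : R).

Definition vconvergent (K : fieldType) (v : K -> R) (u : nat -> K) : Prop :=
  exists l, vcvg v u l.

(* Total limit operator: the value is 0 when the sequence has no limit. *)
Definition vlim (K : fieldType) (v : K -> R) (u : nat -> K) : K :=
  xget 0 [set l | vcvg v u l].

Definition vcauchy (K : fieldType) (v : K -> R) (u : nat -> K) : Prop :=
  forall e : R, 0 < e ->
    exists N : nat, forall m n : nat,
      (N <= m)%N -> (N <= n)%N -> v (u m - u n) < e.

Record is_completion (K L : fieldType) (v : K -> R) (w : L -> R)
    (i : {rmorphism K -> L}) : Prop := IsCompletion {
  completion_abs : ultrametric_abs w;
  completion_ext : forall x, w (i x) = v x;
  completion_complete : forall u, vcauchy w u -> vconvergent w u;
  completion_dense : forall (y : L) (e : R), 0 < e ->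
    exists x : K, w (y - i x) < e }.

(* |x|_p = p ^ (v_p(denominator) - v_p(numerator)) *)
Definition padic_abs (p : nat) (x : rat) : R :=
  if x == 0 then 0
  else p%:R ^ ((logn p `|denq x|%N)%:Z - (logn p `|numq x|%N)%:Z).

End ValuedFields.

Definition is_algebraic_closure (K L : fieldType) (i : {rmorphism K -> L}) :
  Prop :=
  GRing.closed_field_axiom L /\ (forall x : L, algebraicOver i x).

(* (C, v) is a model of the field C_p with its normalized absolute value:
   Q --completion--> Qp --algebraic closure--> Qpbar --completion--> C. *)
Definition is_Cp (R : realType) (p : nat) (C : fieldType) (v : C -> R) : Prop :=
  exists (Qp Qpbar : fieldType) (vQp : Qp -> R) (vQpbar : Qpbar -> R)
         (i : {rmorphism rat -> Qp}) (j : {rmorphism Qp -> Qpbar})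
         (k : {rmorphism Qpbar -> C}),
    [/\ is_completion (@padic_abs R p) vQp i,
        is_algebraic_closure j,
        ultrametric_abs vQpbar /\ (forall x, vQpbar (j x) = vQp x)
      & is_completion vQpbar v k].

Record dirichlet_character (m : nat) (chi : int -> algC) : Prop :=
  DirichletCharacter {
  dchar_periodic : forall x : int, chi (x + m%:Z) = chi x;
  dcharM : forall x y : int, chi (x * y) = chi x * chi y;
  dchar_neq0 : forall x : int, (chi x != 0) = coprimez x m%:Z }.

Definition induced_modulus (m : nat) (chi : int -> algC) (f : nat) : Prop :=
  (f %| m)%N /\
  (forall x : int, coprimez x m%:Z -> (x = 1 %[mod f%:Z])%Z -> chi x = 1).

Definition has_conductor (m : nat) (chi : int -> algC) (f : nat) : Prop :=
  induced_modulus m chi f /\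
  (forall f' : nat, induced_modulus m chi f' -> (f <= f')%N).

(* X = lim_N Z / d p^N Z, a residue class being its representative in
   [0, d p^N[. *)
Record Xlim (d p : nat) := XLim {
  Xcoord : forall N : nat, 'I_(d * p ^ N);
  XcoordP : forall N : nat, Xcoord N.+1 = Xcoord N %[mod d * p ^ N] }.

(* a + d p^N Z_p *)
Definition Xball (d p a N : nat) : set (Xlim d p) :=
  [set x | Xcoord x N = a %[mod d * p ^ N]].

Section Euler.
Variables (R : realType) (C : fieldType) (v : C -> R).

(* [y : Q] *)
Definition qnum (y : nat) (Q : C) : C := (Q ^+ y - 1) / (Q - 1).

Section EulerNumbers.
Variables (d p : nat) (iota : {rmorphism algC -> C}) (chi : int -> algC) (q : C).
Variables (alpha beta : nat).

Definition euler_chi_seq (n N : nat) : C :=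
  (qnum (d * p ^ N) (- q ^+ beta))^-1 *
  \sum_(0 <= y < d * p ^ N)
     (- q ^+ beta) ^+ y * iota (chi y%:Z) * qnum y (q ^+ alpha) ^+ n.

Definition euler_chi (n : nat) : C := vlim v (euler_chi_seq n).

(* The polynomial in base q ^ M at a / M; the quotient is
   [a / M + y : q ^ (M alpha)]. *)
Definition euler_poly_seq (n M a N : nat) : C :=
  (qnum (p ^ N) (- q ^+ (M * beta)))^-1 *
  \sum_(0 <= y < p ^ N)
     (- q ^+ (M * beta)) ^+ y *
     ((1 - q ^+ (alpha * (a + M * y))) / (1 - q ^+ (alpha * M))) ^+ n.

Definition euler_poly (n M a : nat) : C := vlim v (euler_poly_seq n M a).

Definition euler_measure_value (k a N : nat) : C :=
  qnum (d * p ^ N) (q ^+ alpha) ^+ k / qnum (d * p ^ N) (- q ^+ beta) *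
  iota (chi a%:Z) * (-1) ^+ a * q ^+ (beta * a) *
  euler_poly k (d * p ^ N) a.

(* The measure as a function of sets; it is only meaningful on the sets
   a + d p^N Z_p with 0 <= a < d p^N, which determine a and N when p > 1
   and d > 0. *)
Definition euler_measure (k : nat) (U : set (Xlim d p)) : C :=
  xget 0 [set z | exists a N : nat,
    [/\ (a < d * p ^ N)%N, U = Xball a N & z = euler_measure_value k a N]].

End EulerNumbers.

Definition total_integral_seq (d p : nat) (mu : set (Xlim d p) -> C) (N : nat) :
  C :=
  \sum_(0 <= a < d * p ^ N) mu (Xball a N).

(* int_X dmu *)
Definition total_integral (d p : nat) (mu : set (Xlim d p) -> C) : C :=
  vlim v (total_integral_seq mu).

End Euler.

(* Main.v *)
Require Import Defs.
From mathcomp Require Import all_boot all_order all_algebra all_field.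
From mathcomp Require Import boolp classical_sets reals topology normedtype.
From mathcomp Require Import sequences ring.
Import Order.TTheory GRing.Theory Num.Theory.
Import numFieldNormedType.Exports.
Local Open Scope ring_scope.

(** The integral is not really a limit: every Riemann sum, at every level [N],
    already equals the character Euler number.

    Write [M = d * p ^ N] and regroup the partial sum of
    [(- q ^ beta) ^ y * chi y * [y : q ^ alpha] ^ k] over [0 <= y < M * p ^ L]
    by residues [y = a + M * y'].  Since [M] is odd and a multiple of the period
    of [chi], the sign and the power of [q] split multiplicatively, [chi]
    depends on [a] only, and [[a + M * y' : q ^ alpha]] factors as
    [[M : q ^ alpha]] times [[a / M + y' : q ^ (alpha * M)]].  The
    normalising factor splits in the same way.  Hence the partial sum of index
    [N + L] of the character Euler number is the sum over [a < M] of the weight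
    of the measure times the partial sum of index [L] of the Euler polynomial at
    [a / M] ([euler_chi_seq_distribution]).  Letting [L] tend to infinity gives
    the Euler number on the left and the Riemann sum of level [N] on the right.

    The limits exist because the sums are explicit: expanding the [k]-th power
    by the binomial theorem turns the partial sums of an Euler polynomial into
    fixed combinations of the ratios [(1 + z ^ (p ^ N)) / (1 + w ^ (p ^ N))]
    with [z] and [w] powers of [q] ([euler_poly_seqE]).  Both [z ^ (p ^ N)] and
    [w ^ (p ^ N)] tend to 1 ([oneunit_pow_cvg1]), and
    [|1 + w ^ (p ^ N)| = |2| = 1] because [p] is odd, so each ratio tends to 1.  The field [C_p] enters
    through its ultrametric absolute value, with [|2| = 1] and [|p| < 1]
    ([Cp_uabs_nat]). *)

(** * Ultrametric absolute values and convergence *)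

Section UltrametricFields.
Set Implicit Arguments.
Unset Strict Implicit.

Context (R : realType) (K : fieldType) (v : K -> R).
Hypothesis hv : ultrametric_abs v.

Lemma uabs0 : v 0 = 0.
Proof. exact/(uabs_eq0 hv). Qed.

Lemma uabs_neq0 x : x != 0 -> v x != 0.
Proof. by apply: contra_neq => /(uabs_eq0 hv). Qed.

Lemma uabs1 : v 1 = 1.
Proof.
by apply: (mulIf (uabs_neq0 (oner_neq0 K))); rewrite -(uabsM hv) !mul1r.
Qed.

Lemma uabsN x : v (- x) = v x.
Proof.
suff vN1 : v (- 1) = 1 by rewrite -mulN1r (uabsM hv) vN1 mul1r.
apply/eqP; rewrite -(@eqrXn2 _ 2) ?(uabs_ge0 hv) //.
by rewrite expr2 -(uabsM hv) mulrNN mulr1 uabs1 expr1n.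
Qed.

Lemma uabs1_neq0 x : v x = 1 -> x != 0.
Proof.
move=> vx; apply/eqP => x0; move: vx.
by rewrite x0 uabs0 => /esym/eqP; rewrite oner_eq0.
Qed.

Lemma uabs_divr x y : v y = 1 -> v (x / y) = v x.
Proof.
move=> vy.
by rewrite -[in RHS](divfK (uabs1_neq0 vy) x) [RHS](uabsM hv) vy mulr1.
Qed.

Lemma uabs_sum_le (I : Type) (s : seq I) (F : I -> K) (b : R) :
  0 <= b -> (forall i, v (F i) <= b) -> v (\sum_(i <- s) F i) <= b.
Proof.
move=> b0 Fb; elim/big_rec: _ => [|i x _ xb]; first by rewrite uabs0.
by apply: le_trans (uabsD hv _ _) _; rewrite ge_max Fb xb.
Qed.

Lemma uabsD_dominant x y : v y < v x -> v (x + y) = v x.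
Proof.
move=> yx; apply/eqP; rewrite eq_le; apply/andP; split.
  by apply: le_trans (uabsD hv _ _) _; rewrite ge_max lexx ltW.
have := uabsD hv (x + y) (- y).
by rewrite addrK uabsN le_max => /orP[//|/(lt_le_trans yx)]; rewrite ltxx.
Qed.

Lemma uabs_oneunit x : v (x - 1) < 1 -> v x = 1.
Proof.
by move=> x1; rewrite -[x](addrNK 1) addrC uabsD_dominant uabs1.
Qed.

(** Powers of a one-unit are at least as close to 1, because
    [x ^ n - 1 = (x - 1) * (1 + x + ... + x ^ (n - 1))] and the second factor is
    integral. *)
Lemma oneunitX x n : v (x - 1) < 1 -> v (x ^+ n - 1) <= v (x - 1).
Proof.
move=> x1; rewrite subrX1 (uabsM hv) ler_piMr ?(uabs_ge0 hv) //.
apply: uabs_sum_le => // i.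
suff -> : v (x ^+ i) = 1 by [].
by elim: (nat_of_ord i) => [|m IH];
  rewrite ?uabs1 // exprS (uabsM hv) IH uabs_oneunit // mulr1.
Qed.

Lemma oneunitX_lt1 x n : v (x - 1) < 1 -> v (x ^+ n - 1) < 1.
Proof. by move=> x1; apply: le_lt_trans (oneunitX n x1) x1. Qed.

(** In the factorisation of [x ^ p - 1] used for [oneunitX], the second factor
    is [p] plus a sum of terms [x ^ i - 1], hence small.  The contraction factor
    does not grow when [x] is replaced by a power, so it can be iterated. *)
Lemma oneunitXp (p : nat) x : v (x - 1) < 1 ->
  v (x ^+ p - 1) <= v (x - 1) * Num.max (v p%:R) (v (x - 1)).
Proof.
move=> x1; rewrite subrX1 (uabsM hv) ler_wpM2l ?(uabs_ge0 hv) //.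
have -> : \sum_(i < p) x ^+ i = p%:R + \sum_(i < p) (x ^+ i - 1).
  by rewrite sumrB sumr_const card_ord addrC subrK.
apply: le_trans (uabsD hv _ _) _.
rewrite ge_max !le_max lexx /=; apply/orP; right.
by apply: uabs_sum_le => [|i]; rewrite ?(uabs_ge0 hv) ?oneunitX.
Qed.

Lemma oneunit_1D x : v 2%:R = 1 -> v (x - 1) < 1 -> v (1 + x) = 1.
Proof.
move=> v2 x1; have -> : 1 + x = 2%:R + (x - 1) by ring.
by rewrite uabsD_dominant v2.
Qed.

Lemma oneunit_1D_neq0 x : v 2%:R = 1 -> v (x - 1) < 1 -> 1 + x != 0.
Proof. by move=> v2 /(oneunit_1D v2)/uabs1_neq0. Qed.

Lemma vcvg_le (u : nat -> K) l (s : nat -> R) :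
  (forall n, v (u n - l) <= s n) -> (s @ \oo --> (0 : R))%classic ->
  vcvg v u l.
Proof.
move=> us s0; apply: (squeeze_cvgr _ (cvg_cst (0 : R)) s0).
by apply: nearW => n /=; rewrite (uabs_ge0 hv) us.
Qed.

Lemma vcvg_cst l : vcvg v (fun=> l) l.
Proof.
by apply: (@vcvg_le _ _ (fun=> 0)) (cvg_cst _) => n; rewrite subrr uabs0.
Qed.

Lemma vcvgD (u w : nat -> K) l m :
  vcvg v u l -> vcvg v w m -> vcvg v (fun n => u n + w n) (l + m).
Proof.
move=> ul wm; apply: (@vcvg_le _ _ (fun n => v (u n - l) + v (w n - m))).
  move=> n; have -> : u n + w n - (l + m) = (u n - l) + (w n - m) by ring.
  apply: le_trans (uabsD hv _ _) _.
  by rewrite ge_max lerDl lerDr !(uabs_ge0 hv).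
by rewrite -[0 in X in (_ --> X)%classic](addr0 (0 : R)); apply: cvgD.
Qed.

Lemma vcvgMl (c : K) (u : nat -> K) l :
  vcvg v u l -> vcvg v (fun n => c * u n) (c * l).
Proof.
move=> ul; apply: (@vcvg_le _ _ (fun n => v c * v (u n - l))).
  by move=> n; rewrite -mulrBr (uabsM hv).
rewrite -(mulr0 (v c)); exact: cvgM (cvg_cst _) ul.
Qed.

Lemma vcvg_sum (I : Type) (s : seq I) (u : I -> nat -> K) (l : I -> K) :
  (forall i, vcvg v (u i) (l i)) ->
  vcvg v (fun n => \sum_(i <- s) u i n) (\sum_(i <- s) l i).
Proof.
move=> ul; elim: s => [|i s IH].
  rewrite big_nil; have -> : (fun n => \sum_(i <- [::]) u i n) = fun=> 0.
    by apply/funext => n; rewrite big_nil.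
  exact: vcvg_cst.
rewrite big_cons; have -> : (fun n => \sum_(j <- i :: s) u j n) =
    fun n => u i n + \sum_(j <- s) u j n.
  by apply/funext => n; rewrite big_cons.
exact: vcvgD.
Qed.

Lemma vcvg_unique (u : nat -> K) l m : vcvg v u l -> vcvg v u m -> l = m.
Proof.
move=> ul um; apply/eqP; rewrite -subr_eq0; apply/eqP/(uabs_eq0 hv).
have c0 : vcvg v (fun=> l - m) 0.
  apply: (@vcvg_le _ _ (fun n => v (u n - m) + v (u n - l))).
    move=> n; rewrite subr0.
    have -> : l - m = (u n - m) - (u n - l) by ring.
    apply: le_trans (uabsD hv _ _) _.
    by rewrite uabsN ge_max lerDl lerDr !(uabs_ge0 hv).
  by rewrite -[0 in X in (_ --> X)%classic](addr0 (0 : R)); apply: cvgD.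
move: c0; rewrite /vcvg subr0 => c0.
exact: (cvg_unique _ (cvg_cst (v (l - m))) c0).
Qed.

Lemma vcvg_vlim (u : nat -> K) l : vcvg v u l -> vlim v u = l.
Proof. by move=> ul; apply: xget_unique => // m /vcvg_unique; exact. Qed.

Lemma vcvg_shift (u : nat -> K) l N :
  vcvg v u l -> vcvg v (fun n => u (N + n)%N) l.
Proof.
rewrite /vcvg => ul; under eq_fun do rewrite addnC.
by rewrite -(cvg_shiftn N) in ul.
Qed.

Lemma oneunit_pow_cvg1 (p : nat) x : v p%:R < 1 -> v (x - 1) < 1 ->
  vcvg v (fun N => x ^+ (p ^ N)) 1.
Proof.
move=> vp x1; set r := Num.max (v p%:R) (v (x - 1)).
have r0 : 0 <= r by rewrite le_max (uabs_ge0 hv).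
apply: (@vcvg_le _ _ (fun N => r ^+ N)); last first.
  by apply: cvg_expr; rewrite ger0_norm // gt_max vp x1.
elim=> [|N IH]; first by rewrite expr1 expr0 ltW.
have xN := oneunitX_lt1 (p ^ N) x1.
rewrite expnSr exprM; apply: le_trans (oneunitXp _ xN) _.
have rN : Num.max (v p%:R) (v (x ^+ (p ^ N) - 1)) <= r.
  by rewrite ge_max !le_max lexx /= oneunitX ?orbT.
by rewrite mulrC exprS; apply: ler_pM => //;
  rewrite ?le_max (uabs_ge0 hv).
Qed.

End UltrametricFields.

(** * The absolute value of integers in C_p *)

Section CpValues.
Set Implicit Arguments.
Unset Strict Implicit.

Context (R : realType) (p : nat) (C : fieldType) (v : C -> R).

Lemma Cp_uabs : is_Cp p v -> ultrametric_abs v.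
Proof. by move=> [Qp [Qpbar [vQp [vQpbar [i [j [k [_ _ _ []]]]]]]]]. Qed.

Lemma Cp_uabs_nat (n : nat) : is_Cp p v -> (0 < n)%N ->
  v n%:R = p%:R ^- logn p n.
Proof.
move=> [Qp [Qpbar [vQp [vQpbar [i [j [k [cQp _ [_ ej] cC]]]]]]]] n0.
have -> : n%:R = k (j (i n%:R)) by rewrite !rmorph_nat.
rewrite (completion_ext cC) ej (completion_ext cQp) /padic_abs.
have -> : n%:R = (Posz n)%:Q :> rat by rewrite -pmulrn.
have /negPf n0z : n != 0 :> int by rewrite -lt0n.
by rewrite intq_eq0 numq_int denq_int n0z !absz_nat logn1 sub0r exprnN.
Qed.

End CpValues.

(** * q-numbers and sums over residue classes *)

Section QNumbers.
Set Implicit Arguments.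
Unset Strict Implicit.

Context (K : fieldType).
Implicit Types x y : K.

Lemma exprN_odd x n : odd n -> (- x) ^+ n = - x ^+ n.
Proof. by move=> on; rewrite exprNn -signr_odd on expr1 mulN1r. Qed.

Lemma qnumM m n x : x ^+ m != 1 -> qnum (m * n) x = qnum m x * qnum n (x ^+ m).
Proof.
move=> xm; by rewrite /qnum exprM [RHS]mulrC mulrA divfK // subr_eq0.
Qed.

Lemma qnum_alt m x : odd m -> qnum m (- x) = (1 + x ^+ m) / (1 + x).
Proof.
move=> om; rewrite /qnum exprN_odd // -!opprD invrN mulrNN.
by rewrite [x ^+ m + 1]addrC [x + 1]addrC.
Qed.

Lemma alternating_geometric_sum m x : odd m -> 1 + x != 0 ->
  \sum_(0 <= y < m) (- x) ^+ y = (1 + x ^+ m) / (1 + x).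
Proof.
move=> om x1; rewrite big_mkord; apply: (mulIf x1); rewrite divfK //.
have := subrX1 (- x) m; rewrite exprN_odd // => e.
apply: oppr_inj; rewrite [1 + x]addrC [1 + x ^+ m]addrC [RHS]opprD e.
by rewrite mulrC -mulNr opprD.
Qed.

(** For [n = a + m * y] the second factor is the [q]-number of [a / m + y] in
    base [x ^ m]. *)
Lemma qnumD_shift m n x : x ^+ m != 1 ->
  qnum n x = qnum m x * ((1 - x ^+ n) / (1 - x ^+ m)).
Proof.
move=> xm; rewrite -(opprB (x ^+ n)) -(opprB (x ^+ m)) invrN mulrNN.
by rewrite /qnum [RHS]mulrC mulrA divfK // subr_eq0.
Qed.

Lemma sum_nat_residues (M P : nat) (F : nat -> K) :
  \sum_(0 <= y < M * P) F y =
  \sum_(0 <= a < M) \sum_(0 <= y < P) F (a + M * y)%N.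
Proof.
rewrite mulnC big_nat_mul exchange_big_nat; apply: eq_bigr => i _.
rewrite -{1}[(i * M)%N]add0n big_addn mulSn addnK.
by apply: eq_bigr => a _; rewrite mulnC.
Qed.

End QNumbers.

(** * The balls a + d p^N Z_p *)

Section Balls.
Context (d p : nat).
Hypotheses (d0 : (0 < d)%N) (p1 : (1 < p)%N).

Lemma Xlevel_gt0 N : (0 < d * p ^ N)%N.
Proof. by rewrite muln_gt0 d0 expn_gt0 ltnW. Qed.

Lemma Xnat_compat (x N : nat) :
  Ordinal (ltn_pmod x (Xlevel_gt0 N.+1)) =
  Ordinal (ltn_pmod x (Xlevel_gt0 N)) %[mod d * p ^ N].
Proof.
by rewrite /= modn_mod; apply: modn_dvdm; rewrite dvdn_pmul2l // dvdn_exp2l.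
Qed.

Definition Xnat (x : nat) : Xlim d p := XLim (Xnat_compat x).

Lemma Xball_Xnat x a N :
  @Xball d p a N (Xnat x) <-> x = a %[mod d * p ^ N].
Proof. by rewrite /Xball /= modn_mod. Qed.

(** A ball determines its level and its centre, so the measure of a ball is
    unambiguous.  The integers [b] and [b + d * p ^ L] both lie in the ball of
    centre [b] and level [L]; if this is also a ball of level [L'], then
    [d * p ^ L'] divides [d * p ^ L]. *)
Lemma Xball_inj a N a' N' :
  (a < d * p ^ N)%N -> (a' < d * p ^ N')%N ->
  @Xball d p a N = Xball a' N' -> a = a' /\ N = N'.
Proof.
move=> aN aN' eB.
have lvl b L b' L' : @Xball d p b L = Xball b' L' -> (L' <= L)%N.
  move=> e; have hb x : x = b %[mod d * p ^ L] -> x = b' %[mod d * p ^ L'].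
    by move=> /Xball_Xnat; rewrite e => /Xball_Xnat.
  have /eqP := etrans (hb (b + d * p ^ L)%N (modnDr _ _)) (esym (hb b erefl)).
  rewrite -{2}[b]addn0 eqn_modDl mod0n -/(dvdn _ _) dvdn_pmul2l //.
  by rewrite dvdn_Pexp2l.
have eN : N = N'.
  by apply/eqP; rewrite eqn_leq (lvl _ _ _ _ eB) (lvl _ _ _ _ (esym eB)).
subst N'; split=> //.
have /Xball_Xnat : @Xball d p a' N (Xnat a).
  by rewrite -eB; apply/Xball_Xnat.
by rewrite !modn_small.
Qed.

End Balls.

(** * Euler polynomials, Euler numbers and the measure *)

Lemma dchar_periodicX m chi (a y : nat) :
  dirichlet_character m chi -> chi (a + m * y)%N%:Z = chi a%:Z.
Proof.
move=> hchi; elim: y => [|y IH]; first by rewrite muln0 addn0.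
by rewrite mulnS addnCA addnC PoszD (dchar_periodic hchi).
Qed.

Section EulerLimits.
Set Implicit Arguments.
Unset Strict Implicit.

Context (R : realType) (C : fieldType) (v : C -> R) (p : nat) (q : C).
Context (alpha beta k : nat).
Hypotheses (hv : ultrametric_abs v) (v2 : v 2%:R = 1) (vp : v p%:R < 1).
Hypotheses (p_odd : odd p) (hq : v (q - 1) < 1).

Lemma powq_oneunit n : v (q ^+ n - 1) < 1.
Proof. exact: oneunitX_lt1. Qed.

Lemma powq_1D_neq0 n : 1 + q ^+ n != 0.
Proof. exact: (oneunit_1D_neq0 hv v2 (powq_oneunit n)). Qed.

(** The denominators are units of absolute value 1, so the distance to 1 is that
    between [z ^ (p ^ N)] and [w ^ (p ^ N)], and both of these tend to 1. *)
Lemma oneunit_ratio_cvg1 z w : v (z - 1) < 1 -> v (w - 1) < 1 ->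
  vcvg v (fun N => (1 + z ^+ (p ^ N)) / (1 + w ^+ (p ^ N))) 1.
Proof.
move=> z1 w1.
have zc := oneunit_pow_cvg1 hv vp z1; have wc := oneunit_pow_cvg1 hv vp w1.
apply: (vcvg_le hv (s := fun N => v (z ^+ (p ^ N) - 1) + v (w ^+ (p ^ N) - 1))).
  move=> N; have uw : v (1 + w ^+ (p ^ N)) = 1.
    by apply: oneunit_1D => //; apply: oneunitX_lt1.
  rewrite -[X in _ - X](divff (uabs1_neq0 hv uw)) -mulrBl uabs_divr //.
  have -> : 1 + z ^+ (p ^ N) - (1 + w ^+ (p ^ N)) =
    (z ^+ (p ^ N) - 1) - (w ^+ (p ^ N) - 1) by ring.
  apply: le_trans (uabsD hv _ _) _.
  by rewrite uabsN // ge_max lerDl lerDr !(uabs_ge0 hv).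
by rewrite -[0 in X in (_ --> X)%classic](addr0 (0 : R)); apply: cvgD.
Qed.

(** The binomial theorem makes each partial sum a combination of geometric
    series of ratio [- z], [z = q ^ (M * beta + alpha * M * j)], and [N] then
    occurs only in the last factor. *)
Lemma euler_poly_seqE M a N :
  euler_poly_seq p q alpha beta k M a N =
  \sum_(j < k.+1)
    (1 + q ^+ (M * beta)) / (1 + q ^+ (M * beta + alpha * M * j)) *
    ((- q ^+ (alpha * a)) ^+ j *+ 'C(k, j) / (1 - q ^+ (alpha * M)) ^+ k) *
    ((1 + q ^+ (M * beta + alpha * M * j) ^+ (p ^ N)) /
     (1 + q ^+ (M * beta) ^+ (p ^ N))).
Proof.
have oP : odd (p ^ N) by rewrite oddX p_odd orbT.
rewrite /euler_poly_seq qnum_alt // invf_div.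
have -> : \sum_(0 <= y < p ^ N) (- q ^+ (M * beta)) ^+ y *
    ((1 - q ^+ (alpha * (a + M * y))) / (1 - q ^+ (alpha * M))) ^+ k =
  \sum_(j < k.+1) (- q ^+ (alpha * a)) ^+ j *+ 'C(k, j) /
    (1 - q ^+ (alpha * M)) ^+ k *
    \sum_(0 <= y < p ^ N) (- q ^+ (M * beta + alpha * M * j)) ^+ y.
  under [RHS]eq_bigr do rewrite mulr_sumr.
  rewrite exchange_big; apply: eq_bigr => y _.
  rewrite expr_div_n exprDn mulr_suml mulr_sumr; apply: eq_bigr => j _.
  have -> : q ^+ (alpha * (a + M * y)) =
      q ^+ (alpha * a) * q ^+ (alpha * M * y).
    by rewrite mulnDr exprD mulnA.
  have -> : (- q ^+ (M * beta + alpha * M * j)) ^+ y =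
      (- q ^+ (M * beta)) ^+ y * (q ^+ (alpha * M * y)) ^+ j.
    by rewrite exprD -mulNr exprMn -!exprM mulnAC.
  by rewrite expr1n mul1r -mulNr exprMn -!mulrnAl; ring.
rewrite mulr_sumr; apply: eq_bigr => j _.
rewrite alternating_geometric_sum //; last exact: powq_1D_neq0.
ring.
Qed.

Lemma euler_poly_seq_cvg M a :
  vconvergent v (euler_poly_seq p q alpha beta k M a).
Proof.
rewrite (funext (euler_poly_seqE M a)).
eexists; apply: vcvg_sum => // j; apply: vcvgMl => //.
by apply: oneunit_ratio_cvg1; apply: powq_oneunit.
Qed.

Context (d : nat) (iota : {rmorphism algC -> C}) (chi : int -> algC).
Hypotheses (d_odd : odd d) (hchi : dirichlet_character d chi).
Hypotheses (alpha0 : (0 < alpha)%N).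
Hypothesis (q_root : forall n : nat, (0 < n)%N -> q ^+ n <> 1).

(** The factor in front of the Euler polynomial in the measure of the ball of
    centre [a] and modulus [M]. *)
Definition euler_weight (M a : nat) : C :=
  qnum M (q ^+ alpha) ^+ k / qnum M (- q ^+ beta) *
  iota (chi a%:Z) * (-1) ^+ a * q ^+ (beta * a).

(** The finite form of the theorem: summation over [0 <= y < d * p ^ (N + L)]
    split along the classes modulo [d * p ^ N]. *)
Lemma euler_chi_seq_distribution N L :
  euler_chi_seq d p iota chi q alpha beta k (N + L) =
  \sum_(0 <= a < d * p ^ N)
    euler_weight (d * p ^ N) a *
    euler_poly_seq p q alpha beta k (d * p ^ N) a L.
Proof.
rewrite /euler_chi_seq expnD mulnA; set M := (d * p ^ N)%N.
have oM : odd M by rewrite oddM oddX p_odd d_odd orbT.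
rewrite sum_nat_residues mulr_sumr; apply: eq_bigr => a _.
rewrite /euler_poly_seq mulrA !mulr_sumr; apply: eq_bigr => y _.
have eM : (- q ^+ beta) ^+ M = - q ^+ (M * beta).
  by rewrite exprN_odd // -exprM mulnC.
have qM1 : (- q ^+ beta) ^+ M != 1.
  by rewrite eM -subr_eq0 -opprD oppr_eq0 addrC powq_1D_neq0.
have qaM1 : (q ^+ alpha) ^+ M != 1.
  by apply/eqP; rewrite -exprM; apply: q_root; rewrite muln_gt0 alpha0 odd_gt0.
rewrite qnumM // eM invfM (qnumD_shift (a + M * y) qaM1) exprMn -!exprM.
have -> : (- q ^+ beta) ^+ (a + M * y) =
    (-1) ^+ a * q ^+ (beta * a) * (- q ^+ (M * beta)) ^+ y.
  by rewrite exprD (exprM _ M y) eM (exprNn (q ^+ beta) a) -(exprM q beta a).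
have -> : iota (chi (a + M * y)%N%:Z) = iota (chi a%:Z).
  by rewrite /M -mulnA dchar_periodicX.
rewrite /euler_weight; ring.
Qed.

(** For [N = 0] this shows that the character Euler number exists; for general
    [N] it computes it a second time, as the Riemann sum of level [N]. *)
Lemma euler_chi_cvg N :
  vcvg v (fun L => euler_chi_seq d p iota chi q alpha beta k (N + L))
    (\sum_(0 <= a < d * p ^ N)
       euler_weight (d * p ^ N) a *
       euler_poly v p q alpha beta k (d * p ^ N) a).
Proof.
rewrite (funext (euler_chi_seq_distribution N)); apply: vcvg_sum => // a.
have [l ul] := euler_poly_seq_cvg (d * p ^ N) a.
by rewrite /euler_poly (vcvg_vlim hv ul); apply: vcvgMl.
Qed.

Lemma euler_chi_seq_cvg :
  vconvergent v (euler_chi_seq d p iota chi q alpha beta k).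
Proof. by eexists; apply: (euler_chi_cvg 0). Qed.

Lemma euler_measureE a N : (1 < p)%N -> (a < d * p ^ N)%N ->
  euler_measure v iota chi q alpha beta k (@Xball d p a N) =
  euler_measure_value v d p iota chi q alpha beta k a N.
Proof.
move=> p1 aN; apply: xget_unique; first by exists a, N.
move=> _ [a' [N' [aN' eB ->]]].
by have [-> ->] := Xball_inj (odd_gt0 d_odd) p1 aN aN' eB.
Qed.

Lemma total_integral_seqE N : (1 < p)%N ->
  total_integral_seq (@euler_measure R C v d p iota chi q alpha beta k) N =
  euler_chi v d p iota chi q alpha beta k.
Proof.
move=> p1.
have c0 : vcvg v (euler_chi_seq d p iota chi q alpha beta k) _ :=
  euler_chi_cvg 0.
rewrite /euler_chi (vcvg_vlim hv c0).
have -> := vcvg_unique hv (vcvg_shift N c0) (euler_chi_cvg N).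
by apply: eq_big_nat => a /andP[_ aN]; rewrite euler_measureE.
Qed.

End EulerLimits.

Theorem theorem12 (R : realType) (p : nat) (C : fieldType) (v : C -> R)
    (iota : {rmorphism algC -> C}) (q : C) (alpha beta k d : nat)
    (chi : int -> algC)
    (hp : prime p) (hp_odd : odd p)
    (hC : is_Cp p v)
    (hq : v (q - 1) < 1)
    (hq_root : forall n : nat, (0 < n)%N -> q ^+ n <> 1)
    (halpha : (0 < alpha)%N) (hbeta : (0 < beta)%N) (hk : (0 < k)%N)
    (hd_odd : odd d) (hdp : coprime d p)
    (hchi : dirichlet_character d chi) (hcond : has_conductor d chi d) :
  (* the defining limits exist *)
  [/\ forall N a : nat, (a < d * p ^ N)%N ->
        vconvergent v (euler_poly_seq p q alpha beta k (d * p ^ N) a),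
      vconvergent v (euler_chi_seq d p iota chi q alpha beta k)
    & vconvergent v (total_integral_seq
        (@euler_measure R C v d p iota chi q alpha beta k))] /\
  total_integral v (@euler_measure R C v d p iota chi q alpha beta k) =
    euler_chi v d p iota chi q alpha beta k.
Proof.
have hv := Cp_uabs hC; have p1 := prime_gt1 hp.
have v2 : v 2%:R = 1.
  rewrite (Cp_uabs_nat hC) // logn_prime //.
  have /negPf -> : p != 2 by apply: contraTneq hp_odd => ->.
  by rewrite expr0 invr1.
have vp : v p%:R < 1.
  rewrite (Cp_uabs_nat hC) ?prime_gt0 // logn_prime // eqxx expr1.
  by rewrite invf_lt1 ?ltr1n // ltr0n prime_gt0.
have int_cvg : vcvg v (total_integral_seq
    (@euler_measure R C v d p iota chi q alpha beta k))
    (euler_chi v d p iota chi q alpha beta k).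
  have -> : total_integral_seq
      (@euler_measure R C v d p iota chi q alpha beta k) =
      fun=> euler_chi v d p iota chi q alpha beta k.
    by apply/funext => N; apply: total_integral_seqE.
  exact: vcvg_cst.
split; last exact: vcvg_vlim int_cvg.
split; first by move=> N a _; apply: euler_poly_seq_cvg.
  exact: euler_chi_seq_cvg.
by exists (euler_chi v d p iota chi q alpha beta k).
Qed.
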